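(* Let $\Phi$ be a crystallographic root system of rank $n$, let $R \subseteq \Phi$ be a non-empty subset, and let $\Phi'$ be a root subsystem of $\Phi$ containing $R$. Then the following statements are equivalent: (a) $\Phi' = W_R(R)$; (b) $W_{\Phi'} = W_R$; (c) $L(\Phi') = L(R)$ and $L((\Phi')^\vee) = L(R^\vee)$.
   Context: Let $V$ be a finite-dimensional real vector space with a Euclidean inner product $(\cdot\mid\cdot)$. For $0\neq\alpha\in V$ let $s_\alpha$ be the orthogonal reflection $s_\alpha(v) = v - \frac{2(\alpha\mid v)}{(\alpha\mid\alpha)}\alpha$. A root system in $V$ is a finite set $\Phi$ of nonzero vectors of $V$ such that (1) $\mathrm{span}_{\mathbb{R}}(\Phi)=V$; (2) $s_\alpha(\Phi)=\Phi$ for all $\alpha\in\Phi$; (3) $\Phi\cap\mathbb{R}\alpha=\{\pm\alpha\}$ for all $\alpha\in\Phi$. Its rank is $\dim V$. It is crystallographic if $\frac{2(\alpha\mid\beta)}{(\alpha\mid\alpha)}\in\mathbb{Z}$ for all $\alpha,\beta\in\Phi$. (Irreducibility is not assumed.) A root subsystem of $\Phi$ is a subset $\Phi'\subseteq\Phi$ that is a root system in $\mathrm{span}_{\mathbb{R}}(\Phi')$. For a set of roots $R\subseteq\Phi$: $W_R := \langle s_\alpha \mid \alpha\in R\rangle$ is the group generated by the corresponding reflections; $W_R(R) := \{w(\alpha)\mid w\in W_R,\ \alpha\in R\}$; $\alpha^\vee := \frac{2\alpha}{(\alpha\mid\alpha)}$ is the coroot of $\alpha$; $R^\vee := \{\alpha^\vee\mid\alpha\in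 R\}$; $L(R) := \mathrm{span}_{\mathbb{Z}}(R)$ and $L(R^\vee) := \mathrm{span}_{\mathbb{Z}}(R^\vee)$. *)

(* Defs.v *)
From HB Require Import structures.
From mathcomp Require Import all_boot all_order all_algebra finmap.
From mathcomp Require Import boolp classical_sets reals.

Set Implicit Arguments.
Unset Strict Implicit.
Unset Printing Implicit Defensive.

Import Order.TTheory GRing.Theory Num.Theory.
Local Open Scope ring_scope.

Section RootSystems.
Variables (K : realType) (V : vectType K) (ip : {dot V for idfun}).
Implicit Types (a b v : V) (A B : {fset V}) (U : {vspace V}).

Definition reflection_fun a v : V := v - (2 * ip a v / ip a a) *: a.

Lemma reflection_fun_linear a : linear (reflection_fun a).
Proof.
move=> c u v; rewrite /reflection_fun linearPr /= mulrDr mulrDl scalerDl opprD.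
by rewrite addrACA scalerBr scalerA mulrCA !mulrA.
Qed.

HB.instance Definition _ a :=
  GRing.isLinear.Build K V V *:%R (reflection_fun a) (reflection_fun_linear a).

Definition reflection a : 'End(V) := linfun (reflection_fun a).

Lemma reflectionE a v : reflection a v = v - (2 * ip a v / ip a a) *: a.
Proof. by rewrite lfunE. Qed.

Lemma reflectionK a : involutive (reflection a).
Proof.
move=> v; rewrite !reflectionE; have [->|a0] := eqVneq a 0.
  by rewrite !scaler0 !subr0.
have aa : ip a a != 0 by rewrite gt_eqF// neq0_dnorm_gt0.
have -> : ip a (v - (2 * ip a v / ip a a) *: a) = - ip a v.
  rewrite linearBr linearZr_LR /= divfK// mulr2n mulrDl mul1r opprD addrA.
  by rewrite subrr sub0r.
by rewrite mulrN mulNr scaleNr opprK subrK.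
Qed.

(* Root system in the subspace U, for the restriction of ip to U. *)
Record root_system_in U A : Prop := RootSystemIn {
  root_neq0 : 0 \notin A;
  root_span : <<A>>%VS = U;
  root_reflection : forall a, a \in A -> [fset reflection a b | b in A]%fset = A;
  root_line : forall a, a \in A ->
    ([set` A] `&` [set c *: a | c in [set: K]] = [set a; - a])%classic
}.

Definition root_system A : Prop := root_system_in fullv A.

Definition crystallographic A : Prop :=
  forall a b, a \in A -> b \in A -> 2 * ip a b / ip a a \is a Num.int.

Definition root_subsystem A B : Prop :=
  (B `<=` A)%fset /\ root_system_in <<B>> B.

(* The subgroup of GL(V) generated by the reflections in the elements of A;
   f^-1 for f : 'End(V) is a true inverse here, by reflection_group_lker0. *)
Inductive in_reflection_group A : 'End(V) -> Prop :=
| refl_group_gen a : a \in A -> in_reflection_group A (reflection a)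
| refl_group_id : in_reflection_group A \1%VF
| refl_group_comp f g : in_reflection_group A f -> in_reflection_group A g ->
    in_reflection_group A (f \o g)%VF
| refl_group_inv f : in_reflection_group A f -> in_reflection_group A (f^-1)%VF.

Lemma reflection_group_lker0 A f : in_reflection_group A f -> lker f == 0%VS.
Proof.
elim=> [a _||{}f g _ kf _ kg|{}f _ kf].
- by apply/lker0P; exact: inv_inj (@reflectionK a).
- by apply/lker0P => u v; rewrite !id_lfunE.
- apply/lker0P => u v; rewrite !comp_lfunE.
  by move=> /(lker0P kf) /(lker0P kg).
- apply/lker0P => u v e; have lf w : f ((f^-1)%VF w) = w.
    by apply: limg_lfunVK; rewrite (lker0_limgf kf) memvf.
  by rewrite -[u]lf e lf.
Qed.

Definition reflection_group A : set 'End(V) := [set f | in_reflection_group A f]%classic.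

Definition reflection_orbit A : set V :=
  [set f a | f in reflection_group A & a in [set` A]]%classic.

Definition coroot a : V := (2 / ip a a) *: a.

Definition coroots A : {fset V} := [fset coroot a | a in A]%fset.

End RootSystems.

Definition int_span (V : zmodType) (A : {fset V}) : set V :=
  [set v | inIntSpan (in_tuple (enum_fset A)) v]%classic.

(* Main.v *)
Require Import Defs.
From HB Require Import structures.
From mathcomp Require Import all_boot all_order all_algebra finmap.
From mathcomp Require Import boolp classical_sets reals zify ring lra.

Set Implicit Arguments.
Unset Strict Implicit.
Unset Printing Implicit Defensive.

(** Write A for the orbit W_R(R); it is contained in Phi', because the roots of R
are roots of Phi' and Phi' is stable under its own reflections.

If Phi' = A, each root of Phi' is w(b) with w in W_R and b in R, and its
reflection is the conjugate w s_b w^-1; so W_Phi' = W_R.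

If W_Phi' = W_R, then first Phi' = A (lemma reflection_in_group_orbit): a root a
whose reflection lies in W_R belongs to A.  Pick one root from each pair b, -b of
a reduced root set B and let P_B(x) be the product of the (x | b) over this half.
It is antisymmetric: P_B(s_g x) = - P_B(x) for g in B, hence it is multiplied by
(-1)^k under a product of k reflections.  Write s_a as a product of k reflections
in R.  Taking B = Phi', where s_a itself changes the sign, shows that k is odd.
Were a not in A, the hyperplane orthogonal to a would contain a point y orthogonal
to no root of A; with B = A this gives P_A(y) = P_A(s_a y) = - P_A(y), although
P_A(y) is nonzero.  Once Phi' = A, the equality of the lattices holds because
s_g(b) - b is an integer multiple of g, and likewise for coroots
(orbit_int_span).

If the lattices agree, a root a of Phi' is a sum of terms of R and -R, and a is
shown to be in A by induction on the number of terms (orbit_of_sum).  As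
(a | a) > 0, some term b has (a | b) > 0.  If b is at least as long as a and
differs from it, then s_b(a) = a - b, a root of Phi' which is a sum of fewer terms.
If instead a is at least as long as b, the same holds for the coroots.  One of
the two arguments applies uniformly to a, since among the roots that are not
orthogonal to a there cannot be both strictly longer and strictly shorter ones
(short_or_long): the length ratios that a crystallographic root system allows
leave no room for two successive jumps. *)

Import Order.TTheory GRing.Theory Num.Theory.
Local Open Scope ring_scope.

(** * Integral spans *)

Lemma int_span0 (M : zmodType) (A : {fset M}) : int_span A 0.
Proof. by exists [ffun=> 0]; rewrite big1// => i _; rewrite ffunE mulr0z. Qed.

Lemma int_spanD (M : zmodType) (A : {fset M}) u v :
  int_span A u -> int_span A v -> int_span A (u + v).
Proof.
move=> [k ->] [l ->]; exists [ffun i => k i + l i].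
by rewrite -big_split; apply: eq_bigr => i _; rewrite ffunE mulrzDr.
Qed.

Lemma int_spanMz (M : zmodType) (A : {fset M}) u (n : int) :
  int_span A u -> int_span A (u *~ n).
Proof.
move=> [k ->]; exists [ffun i => k i * n].
by rewrite mulrz_suml; apply: eq_bigr => i _; rewrite ffunE mulrzA.
Qed.

Lemma int_span_gen (M : zmodType) (A : {fset M}) u : u \in A -> int_span A u.
Proof.
move=> uA; have uA' : (index u A < size A)%N by rewrite index_mem.
exists [ffun i => (i == Ordinal uA' : nat)%:Z].
rewrite (bigD1 (Ordinal uA')) //= ffunE eqxx mulr1z nth_index// big1 ?addr0// => i.
by rewrite ffunE => /negbTE ->; rewrite mulr0z.
Qed.

Lemma int_span_sub (M : zmodType) (A B : {fset M}) :
  (forall u, u \in A -> int_span B u) -> (int_span A `<=` int_span B)%classic.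
Proof.
move=> AB _ [k ->]; apply: big_ind => [|u v|i _]; [exact: int_span0|exact: int_spanD|].
by apply: int_spanMz; apply: AB; apply: mem_nth.
Qed.

(** Trades integer coefficients for repeated and negated terms, so that an
induction on the length of a combination can remove one term at a time. *)
Lemma int_span_sum (M : zmodType) (A : {fset M}) v : int_span A v ->
  exists2 s : seq M, (forall c, c \in s -> c \in A \/ - c \in A)
    & v = \sum_(c <- s) c.
Proof.
pose P (v : M) := exists2 s : seq M,
  (forall c, c \in s -> c \in A \/ - c \in A) & v = \sum_(c <- s) c.
move=> [k ->]; apply: (big_ind P) => [|_ _ [s sA ->] [t tA ->]|i _].
- by exists [::] => //; rewrite big_nil.
- by exists (s ++ t); [move=> c; rewrite mem_cat => /orP[/sA|/tA]|rewrite big_cat].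
set c := nth _ _ _; have cA : c \in A by apply: mem_nth.
case: (k i) => n.
  exists (nseq n c); first by move=> d; rewrite mem_nseq => /andP[_ /eqP ->]; left.
  by rewrite big_nseq iter_addr_0 -pmulrn.
exists (nseq n.+1 (- c)).
  by move=> d; rewrite mem_nseq => /andP[_ /eqP ->]; right; rewrite opprK.
by rewrite big_nseq iter_addr_0 NegzE mulrNz -pmulrn mulNrn.
Qed.

Section ReflectionSubgroups.
Variables (K : realType) (V : vectType K) (ip : {dot V for idfun}).
Implicit Types (a b c g u v x y : V) (A B R : {fset V}) (s t : seq V).
Local Notation refl := (reflection ip).

(** * Reflections and root systems *)

Lemma ipC u v : ip u v = ip v u.
Proof. by rewrite hermC /= expr0 mul1r. Qed.

Lemma ip_gt0 u : u != 0 -> 0 < ip u u.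
Proof. exact: neq0_dnorm_gt0. Qed.

Lemma ip_neq0 u : u != 0 -> ip u u != 0.
Proof. by move=> /ip_gt0 /gt_eqF ->. Qed.

Lemma ipBl u v w : ip (u - v) w = ip u w - ip v w.
Proof. by rewrite linearBl. Qed.
Lemma ipZl (k : K) u w : ip (k *: u) w = k * ip u w.
Proof. by rewrite linearZl_LR. Qed.
Lemma ipDl u v w : ip (u + v) w = ip u w + ip v w.
Proof. by rewrite linearDl. Qed.
Lemma ipNl u w : ip (- u) w = - ip u w.
Proof. by rewrite linearNl. Qed.
Lemma ipBr u v w : ip w (u - v) = ip w u - ip w v.
Proof. by rewrite linearBr. Qed.
Lemma ipZr (k : K) u w : ip w (k *: u) = k * ip w u.
Proof. by rewrite linearZr_LR. Qed.
Lemma ipNr u w : ip w (- u) = - ip w u.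
Proof. by rewrite linearNr. Qed.

Lemma refl_adj a u v : ip (refl a u) v = ip u (refl a v).
Proof. by rewrite !reflectionE ipBl ipBr ipZl ipZr (ipC u a); ring. Qed.

Lemma refl_isom a u v : ip (refl a u) (refl a v) = ip u v.
Proof. by rewrite refl_adj reflectionK. Qed.

Lemma refl_self a : refl a a = - a.
Proof.
rewrite reflectionE; have [->|a0] := eqVneq a 0; first by rewrite scaler0 subr0 oppr0.
by rewrite mulfK ?ip_neq0// scaler_nat mulr2n opprD addNKr.
Qed.

Lemma refl_orth a u : ip a u = 0 -> refl a u = u.
Proof. by move=> au; rewrite reflectionE au mulr0 mul0r scale0r subr0. Qed.

Lemma reflN a : refl (- a) = refl a.
Proof.
apply/lfunP => v; rewrite !reflectionE !ipNl ipNr opprK scalerN.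
by rewrite mulrN mulNr scaleNr opprK.
Qed.

Lemma reflB a u v : refl a (u - v) = refl a u - refl a v.
Proof. exact: linearB. Qed.

Lemma reflZ a (k : K) v : refl a (k *: v) = k *: refl a v.
Proof. exact: linearZ. Qed.

Lemma refl_conj a b v : refl (refl a b) v = refl a (refl b (refl a v)).
Proof.
rewrite (reflectionE _ (refl a b)) (reflectionE _ b) reflB reflZ reflectionK.
by rewrite refl_isom refl_adj.
Qed.
Lemma root_line_eq U B a (k : K) : root_system_in ip U B -> a \in B ->
  k *: a \in B -> k *: a = a \/ k *: a = - a.
Proof.
move=> rB aB kaB; have E := root_line rB aB.
have : ([set a; - a])%classic (k *: a) by rewrite -E; split => //; exists k.
by [].
Qed.

Lemma root_opp U B a : root_system_in ip U B -> a \in B -> - a \in B.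
Proof.
move=> rB aB; have E := root_line rB aB.
have : ([set a; - a])%classic (- a) by right.
by rewrite -E => -[].
Qed.

Lemma root_refl U B a b : root_system_in ip U B -> a \in B -> b \in B -> refl a b \in B.
Proof. by move=> rB aB bB; rewrite -{1}(root_reflection rB aB) in_imfset. Qed.

(** * Vectors off finitely many hyperplanes *)


Lemma exists_notin (l : seq K) : exists k : K, k \notin l.
Proof.
suff [k Hk] : exists k : K, forall z : K, z \in l -> z < k.
  by exists k; apply/negP => /Hk; rewrite ltxx.
elim: l => [|r l [k Hk]]; first by exists 0.
exists (Num.max k (r + 1)) => z; rewrite inE lt_max => /orP[/eqP ->|/Hk ->//].
by rewrite ltrDl ltr01 orbT.
Qed.

Lemma exists_generic s : 0 \notin s -> exists y, forall b, b \in s -> ip y b != 0.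
Proof.
elim: s => [|b s IH]; first by exists 0.
rewrite inE negb_or eq_sym => /andP[b0 /IH[y Hy]].
have [yb|yb] := eqVneq (ip y b) 0; last first.
  by exists y => c; rewrite inE => /orP[/eqP ->|/Hy].
have [k] := exists_notin (0 :: [seq - ip y c / ip b c | c <- s]).
rewrite inE negb_or => /andP[k0 ks]; exists (y + k *: b) => c.
rewrite ipDl ipZl inE => /orP[/eqP ->|cs].
  by rewrite yb add0r mulf_neq0 ?ip_neq0.
have [bc|bc] := eqVneq (ip b c) 0; first by rewrite bc mulr0 addr0 Hy.
apply: contra ks => /eqP e; apply/mapP; exists c => //.
by rewrite (_ : ip y c = - (k * ip b c)) ?opprK ?mulfK//; lra.
Qed.

(** The orthogonal projection p to the hyperplane of g kills no b outside the
line of g; as p is self-adjoint, p(y) is off the hyperplanes of the b as soon as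
y is off those of the p(b). *)
Lemma exists_generic_orth g s : g != 0 ->
  (forall b, b \in s -> forall k, b != k *: g) ->
  exists y, ip y g = 0 /\ forall b, b \in s -> ip y b != 0.
Proof.
move=> g0 Hs; pose p b := b - (ip g b / ip g g) *: g.
have [|y Hy] := @exists_generic [seq p b | b <- s].
  apply/mapP => -[b bs /esym/eqP]; rewrite subr_eq0; exact/negP/Hs.
exists (p y); split; first by rewrite ipBl ipZl divfK ?ip_neq0// ipC subrr.
move=> b bs; have := Hy _ (map_f p bs).
by rewrite (_ : ip y (p b) = ip (p y) b)// ipBl ipZl ipBr ipZr (ipC g y); ring.
Qed.

(** * The antisymmetric product of a root system *)

Definition half_system B (h : pred V) := forall b, b \in B -> h (- b) = ~~ h b.
Definition half_prod B (h : pred V) x : K := \prod_(b <- B | h b) ip x b.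

Lemma perm_map_stable B (f : V -> V) :
  injective f -> (forall b, b \in B -> f b \in B) ->
  perm_eq [seq f b | b <- B] B.
Proof.
move=> fI fB; have uB := fset_uniq B.
have u : uniq [seq f b | b <- B] by rewrite map_inj_uniq.
apply: uniq_perm => //.
have sub : {subset [seq f b | b <- B] <= B} by move=> _ /mapP[b bB ->]; exact: fB.
by apply: (uniq_min_size u sub _).2; rewrite size_map.
Qed.

(** Passing to another half replaces some factors (x | b) by (x | -b), so only
the sign changes, and it does so in the same way for all x. *)
Lemma half_prod_change B h h' : (forall b, b \in B -> - b \in B) ->
  half_system B h -> half_system B h' ->
  exists k, forall x, half_prod B h x = k * half_prod B h' x.
Proof.
move=> oppB hh hh'; exists (\prod_(b <- B | h b && ~~ h' b) -1) => x.
rewrite /half_prod (bigID h') [X in _ = _ * X](bigID h) /=.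
rewrite mulrCA; congr (_ * _); first by apply: eq_bigl => b; rewrite andbC.
(* Reindexing by the opposite turns the roots of h' outside h into those of h
   outside h'. *)
have negB := perm_map_stable (@oppr_inj V) oppB.
rewrite -[X in _ = _ * X](perm_big _ negB) big_map big_mkcond.
rewrite [X in _ = X * _]big_mkcond [X in _ = _ * X]big_mkcond /= -big_split /=.
rewrite big_seq [RHS]big_seq; apply: eq_bigr => b bB.
rewrite hh' // hh // negbK andbC.
by case: ifP => _; rewrite ?mulr1// ipNr mulN1r opprK.
Qed.

(** By half_prod_change the half may be chosen to suit g: take g itself together
with the roots on the positive side of a vector y orthogonal to g and to no root
other than g and -g.  As s_g fixes y, it permutes the roots of this half other
than g, and it changes the sign of g. *)
Lemma half_prod_refl B h g x : 0 \notin B -> (forall b, b \in B -> - b \in B) ->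
  g \in B -> (forall b, b \in B -> refl g b \in B) ->
  (forall k, k *: g \in B -> k *: g = g \/ k *: g = - g) ->
  half_system B h ->
  half_prod B h (refl g x) = - half_prod B h x.
Proof.
move=> B0 oppB gB rB lineB hh.
have g0 : g != 0 by apply: contraNneq B0 => <-.
have gNg : g != - g.
  by rewrite -subr_eq0 opprK -mulr2n -scaler_nat scaler_eq0 negb_or pnatr_eq0.
pose s := [seq b <- B | (b != g) && (b != - g)].
have [b|y [yg ys]] := @exists_generic_orth g s g0.
  rewrite mem_filter => /andP[/andP[bg bNg] bB] k.
  by apply/eqP => E; move: bB bg bNg; rewrite E => /lineB[] ->; rewrite eqxx.
(* The sign of (y | b) does not separate g from -g: g is put into the half. *)
pose h' b := (0 < ip y b) || (b == g).
have hh' : half_system B h'.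
  move=> b bB; rewrite /h' ipNr oppr_gt0 eqr_oppLR.
  have [->|bg] := eqVneq b g; first by rewrite yg ltxx (negbTE gNg).
  have [->|bNg] := eqVneq b (- g); first by rewrite ipNr yg oppr0 ltxx.
  have : ip y b != 0 by apply: ys; rewrite mem_filter bg bNg bB.
  by rewrite !orbF -leNgt lt_neqAle => ->.
have [k Hk] := half_prod_change oppB hh hh'; rewrite !Hk -mulrN; congr (_ * _).
rewrite /half_prod ![\prod_(b <- B | h' b) _](bigID (pred1 g)) /= -mulNr.
have E z : \prod_(b <- B | h' b && (b == g)) ip z b = ip z g.
  rewrite (eq_bigl (pred1 g)); last first.
    move=> b /=; rewrite /h' andb_orl andbb.
    by case: eqP => [->|//]; rewrite ?andbF ?orbT.
  by rewrite -big_filter filter_pred1_uniq ?fset_uniq// big_seq1.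
rewrite !E; congr (_ * _); first by rewrite refl_adj refl_self ipNr.
have permB := perm_map_stable (inv_inj (@reflectionK _ _ ip g)) rB.
rewrite -[in RHS](perm_big _ permB) big_map /= big_seq_cond [RHS]big_seq_cond.
apply: eq_big => [b|b _]; last by rewrite refl_adj.
case bB: (b \in B) => //=; rewrite /h' -refl_adj refl_orth; last by rewrite ipC.
have [->|bg] := eqVneq b g; first by rewrite yg ltxx refl_self eq_sym (negbTE gNg).
have [e|bNg] := eqVneq (refl g b) g; last by rewrite !orbF.
by rewrite -[b](reflectionK ip g) e refl_self ipNr yg oppr0 ltxx.
Qed.

(** * Words in reflections *)

Definition reflect_word s v := foldr (fun a => refl a) v s.

Lemma reflect_word_rev s : cancel (reflect_word s) (reflect_word (rev s)).
Proof.
move=> v; elim: s => //= a s IH.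
by rewrite rev_cons -cats1 /reflect_word foldr_cat /= reflectionK.
Qed.

Lemma reflection_group_word A f : in_reflection_group ip A f ->
  exists2 s, {subset s <= A} & f =1 reflect_word s.
Proof.
elim=> {f} [a aA||f g _ [s sA fs] _ [t tA gt]|f gf [s sA fs]].
- by exists [:: a] => // b; rewrite inE => /eqP ->.
- by exists [::] => // v; rewrite id_lfunE.
- exists (s ++ t) => [b|v]; first by rewrite mem_cat => /orP[/sA|/tA].
  by rewrite comp_lfunE gt fs /reflect_word foldr_cat.
exists (rev s) => [b|v]; first by rewrite mem_rev => /sA.
have wK := reflect_word_rev (rev s); rewrite revK in wK.
by rewrite -{1}[v]wK -fs lker0_lfunK// (reflection_group_lker0 gf).
Qed.

Lemma reflect_word_group A s : {subset s <= A} ->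
  exists2 f, in_reflection_group ip A f & f =1 reflect_word s.
Proof.
elim: s => [_|a s IH sA].
  by exists \1%VF; [constructor|move=> v; rewrite id_lfunE].
have [|f gf fs] := IH; first by move=> b bs; apply: sA; rewrite inE bs orbT.
exists (refl a \o f)%VF; last by move=> v; rewrite comp_lfunE fs.
by apply: refl_group_comp => //; apply: refl_group_gen; apply: sA; rewrite mem_head.
Qed.

Lemma reflection_orbitP A v : reflection_orbit ip A v <->
  exists s b, [/\ {subset s <= A}, b \in A & v = reflect_word s b].
Proof.
split=> [[f /reflection_group_word[s sA fs] [b bA <-]]|[s [b [sA bA ->]]]].
  by exists s, b; split.
by have [f gf fs] := reflect_word_group sA; exists f => //; exists b.
Qed.

Lemma orbit_gen A a : a \in A -> reflection_orbit ip A a.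
Proof. by move=> aA; apply/reflection_orbitP; exists [::], a; split. Qed.

Lemma orbit_refl A g b : g \in A ->
  reflection_orbit ip A b -> reflection_orbit ip A (refl g b).
Proof.
move=> gA /reflection_orbitP[s [c [sA cA ->]]]; apply/reflection_orbitP.
by exists (g :: s), c; split => // d; rewrite inE => /orP[/eqP ->|/sA].
Qed.

Lemma orbit_ind A (P : V -> Prop) : (forall a, a \in A -> P a) ->
  (forall g b, g \in A -> P b -> P (refl g b)) ->
  forall v, reflection_orbit ip A v -> P v.
Proof.
move=> PA Ps v /reflection_orbitP[s [c [sA cA ->]]].
elim: s sA => [_|g s IH sA] /=; first exact: PA.
apply: Ps; first by apply: sA; rewrite mem_head.
by apply: IH => d ds; apply: sA; rewrite inE ds orbT.
Qed.

Lemma orbit_opp A b : reflection_orbit ip A b -> reflection_orbit ip A (- b).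
Proof.
move: b; apply: orbit_ind => [a aA|g b gA]; last by rewrite -raddfN; exact: orbit_refl.
by rewrite -refl_self; apply: orbit_refl => //; apply: orbit_gen.
Qed.

(** * Reflections in the group generated by some of them *)

Lemma half_prod_word B R h s x : 0 \notin B -> (forall b, b \in B -> - b \in B) ->
  (forall g, g \in R -> g \in B) ->
  (forall g b, g \in R -> b \in B -> refl g b \in B) ->
  (forall b k, b \in B -> k *: b \in B -> k *: b = b \/ k *: b = - b) ->
  half_system B h ->
  {subset s <= R} ->
  half_prod B h (reflect_word s x) = (-1) ^+ size s * half_prod B h x.
Proof.
move=> B0 oppB RB rB lineB hh; elim: s => [|g s IH] sR /=; first by rewrite mul1r.
have gR : g \in R by apply: sR; rewrite mem_head.
rewrite half_prod_refl//; [|exact: RB|by move=> b; apply: rB|]; last first.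
  by move=> k; apply: lineB; exact: RB.
rewrite IH; first by rewrite exprS mulN1r mulNr.
by move=> d ds; apply: sR; rewrite inE ds orbT.
Qed.

Lemma half_generic B y : (forall b, b \in B -> ip y b != 0) ->
  half_system B (fun b => 0 < ip y b).
Proof. by move=> Hy b bB /=; rewrite ipNr oppr_gt0 -leNgt lt_neqAle Hy. Qed.

Lemma half_prod_neq0 B y : half_prod B (fun b => 0 < ip y b) y != 0.
Proof. by rewrite gt_eqF// prodr_gt0. Qed.

(** The parity of a word for the reflection of a, read off B, is odd; read off
the orbit at a point that this reflection fixes, it would be even. *)
Lemma reflection_in_group_orbit U B R a : root_system_in ip U B -> (R `<=` B)%fset ->
  a \in B -> in_reflection_group ip R (refl a) -> reflection_orbit ip R a.
Proof.
move=> rB /fsubsetP RB aB /reflection_group_word[s sR es].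
have B0 := root_neq0 rB; have oppB b := root_opp (a := b) rB.
have lineB b k : b \in B -> k *: b \in B -> k *: b = b \/ k *: b = - b.
  by move=> bB; exact: root_line_eq rB bB.
have [x Hx] := exists_generic B0.
(* The equation par says that the length of s is odd. *)
have reflB g b (gR : g \in R) := root_refl (b := b) rB (RB g gR).
have := half_prod_word x B0 oppB RB reflB lineB (half_generic Hx) sR.
rewrite -es half_prod_refl//; last exact: half_generic; last first.
- by move=> k; apply: lineB.
- by move=> b; exact: root_refl rB aB.
rewrite -[LHS]mulN1r => E; have par := mulIf (half_prod_neq0 B x) E.
have [//|na] := pselect (reflection_orbit ip R a).
pose A := [fset b in B | `[< reflection_orbit ip R b >]]%fset.
have AP b : reflect (b \in B /\ reflection_orbit ip R b) (b \in A).
  by rewrite !inE; apply: (iffP andP) => -[? /asboolP].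
have AB b : b \in A -> b \in B by case/AP.
have a0 : a != 0 by apply: contraNneq B0 => <-.
have [|y [ya Hy]] := @exists_generic_orth a A a0.
  move=> b /AP[bB ob] k; apply/eqP => e; apply: na.
  move: ob bB; rewrite e => ob /(root_line_eq rB aB) [] e2; rewrite e2 in ob => //.
  by rewrite -[a]opprK; apply: orbit_opp.
have := @half_prod_word A R _ s y _ _ _ _ _ (half_generic Hy) sR.
rewrite -es refl_orth 1?ipC// -par mulN1r => /(_ _ _ _ _ _)/eqP.
rewrite -addr_eq0 -mulr2n mulrn_eq0 /= (negbTE (half_prod_neq0 _ _)) => F.
suff : false by []; apply: F.
- by apply: contra B0 => /AB.
- by move=> b /AP[bB ob]; apply/AP; split; [apply: oppB|apply: orbit_opp].
- by move=> g gR; apply/AP; split; [apply: RB|apply: orbit_gen].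
- move=> g b gR /AP[bB ob]; apply/AP; split; last exact: orbit_refl.
  exact: root_refl rB (RB g gR) bB.
- by move=> b k /AB bB /AB; apply: lineB.
Qed.


(** * Lattices of roots and coroots *)

Lemma coroot_refl g b : coroot ip (refl g b) =
  coroot ip b - (2 * ip b g / ip b b) *: coroot ip g.
Proof.
rewrite /coroot refl_isom -reflZ reflectionE ipZr !scalerA; congr (_ - _ *: _).
by rewrite (ipC g b); ring.
Qed.

Lemma corootN b : coroot ip (- b) = - coroot ip b.
Proof. by rewrite /coroot ipNl ipNr opprK scalerN. Qed.

Lemma crystallographic_intr B a b : crystallographic ip B -> a \in B -> b \in B ->
  exists n : int, 2 * ip a b / ip a a = n%:~R.
Proof. by move=> cB aB bB; apply/intrP/cB. Qed.

Lemma orbit_int_span U B R v :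
  root_system_in ip U B -> crystallographic ip B -> (R `<=` B)%fset ->
  reflection_orbit ip R v ->
  [/\ v \in B, int_span R v & int_span (coroots ip R) (coroot ip v)].
Proof.
move=> rB cB /fsubsetP RB; move: v.
have mR a : a \in R -> int_span (coroots ip R) (coroot ip a).
  by move=> aR; apply/int_span_gen/imfsetP; exists a.
apply: orbit_ind => [a aR|g b gR [bB ib jb]].
  by split; [exact: RB|exact: int_span_gen|exact: mR].
have gB := RB _ gR.
split; first exact: root_refl rB gB bB.
  rewrite reflectionE; have [n ->] := crystallographic_intr cB gB bB.
  rewrite -scaleNr -mulrNz scaler_int; apply: int_spanD => //; apply: int_spanMz.
  exact: int_span_gen.
rewrite coroot_refl; have [n ->] := crystallographic_intr cB bB gB.
rewrite -scaleNr -mulrNz scaler_int; apply: int_spanD => //; apply: int_spanMz.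
exact: mR.
Qed.

(** The Cartan integers p = 2(a|b)/(b|b) and q = 2(a|b)/(a|a) satisfy 1 <= p <= q,
and p q < 4 by the strict Cauchy-Schwarz inequality; hence p = 1 and q <= 3. *)
Lemma cartan_pos U B a b : root_system_in ip U B -> crystallographic ip B ->
  a \in B -> b \in B -> a != b -> 0 < ip a b -> ip a a <= ip b b ->
  2 * ip a b = ip b b /\ exists2 m : int, (1 <= m <= 3) & ip b b = m%:~R * ip a a.
Proof.
move=> rB cB aB bB ab ab0 le_ab.
have a0 : a != 0 by apply: contraNneq (root_neq0 rB) => <-.
have aa := ip_gt0 a0.
have bb := lt_le_trans aa le_ab.
have CS : ip a b * ip a b < ip a a * ip b b.
  pose k := ip a b / ip a a; have kE : ip a b = k * ip a a by rewrite divfK ?gt_eqF.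
  have : b - k *: a != 0.
    rewrite subr_eq0; apply/eqP => e; move: bB; rewrite e => /(root_line_eq rB aB).
    rewrite -e => -[e2|e2]; first by rewrite e2 eqxx in ab.
    by move: ab0; rewrite e2 ipNr oppr_gt0 ltNge ltW.
  move=> /ip_gt0; rewrite ipBl !ipBr !ipZl !ipZr (ipC b a) kE => H; nra.
have [p pE] := crystallographic_intr cB bB aB.
have [q qE] := crystallographic_intr cB aB bB.
rewrite ipC in pE.
have pE' : 2 * ip a b = p%:~R * ip b b by rewrite -pE divfK ?gt_eqF.
have qE' : 2 * ip a b = q%:~R * ip a a by rewrite -qE divfK ?gt_eqF.
have p0 : 0 < p by rewrite -(ltr0z K) -pE divr_gt0// mulr_gt0.
have q0 : 0 < q by rewrite -(ltr0z K) -qE divr_gt0// mulr_gt0.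
have pq : p <= q by rewrite -(ler_int K) -pE -qE ler_pM2l ?mulr_gt0// lef_pV2.
have pq4 : p * q < 4.
  rewrite -(ltr_int K) rmorphM /= -(ltr_pM2r (mulr_gt0 aa bb)).
  have -> : p%:~R * q%:~R * (ip a a * ip b b) = 4 * (ip a b * ip a b) :> K.
    transitivity ((p%:~R * ip b b) * (q%:~R * ip a a)); first by ring.
    by rewrite -pE' -qE'; ring.
  by rewrite ltr_pM2l.
have p1 : p = 1 by nia.
rewrite p1 mul1r in pq4; rewrite p1 mulr1z mul1r in pE'.
by split; [|exists q; [lia|rewrite -pE']].
Qed.

(** * Short and long roots *)

Lemma norm_ratio U B a b : root_system_in ip U B -> crystallographic ip B ->
  a \in B -> b \in B -> ip a b != 0 -> ip a a <= ip b b ->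
  exists2 m : int, (1 <= m <= 3) & ip b b = m%:~R * ip a a.
Proof.
move=> rB cB aB bB.
wlog ab0 : a aB / 0 < ip a b.
  move=> H ab0; case: (ltgtP 0 (ip a b)) => [|ab1|ab1]; first by move=> ?; apply: H.
    have := H (- a) (root_opp rB aB); rewrite !ipNl ipNr opprK oppr_gt0 oppr_eq0.
    by apply.
  by rewrite ab1 eqxx in ab0.
move=> _ le_ab; have [->|ab] := eqVneq a b; first by exists 1; rewrite ?mul1r.
by have [] := cartan_pos rB cB aB bB ab ab0 le_ab.
Qed.

(** Length is compared only with the non-orthogonal roots, which takes the place
of the irreducible component of a. *)
Definition short_root B a := forall b, b \in B -> ip a b != 0 -> ip a a <= ip b b.
Definition long_root B a := forall b, b \in B -> ip a b != 0 -> ip b b <= ip a a.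

(** Suppose that b is shorter and c longer than a, neither orthogonal to a.
Replacing c by s_a(c) if necessary, b and c are not orthogonal either.  Each of
(a|a)/(b|b) and (c|c)/(a|a) is then at least 2, while their product (c|c)/(b|b) is
at most 3. *)
Lemma short_or_long U B a : root_system_in ip U B -> crystallographic ip B -> a \in B ->
  short_root B a \/ long_root B a.
Proof.
move=> rB cB aB.
have [/hasP[b bB /andP[ab0 ba]]|/hasPn H] :=
  boolP (has (fun b => (ip a b != 0) && (ip b b < ip a a)) B); last first.
  by left => b bB ab0; have := H b bB; rewrite ab0 /= -leNgt.
right => c cB' ac0; rewrite leNgt; apply/negP => ac.
wlog bc0 : c cB' ac0 ac / ip b c != 0.
  move=> H; have [bc0|] := eqVneq (ip b c) 0; last exact: H.
  apply: (H (refl a c)); rewrite ?refl_isom//; first exact: root_refl rB aB cB'.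
    by rewrite -refl_adj refl_self ipNl oppr_eq0.
  rewrite reflectionE ipBr ipZr bc0 sub0r oppr_eq0 !mulf_neq0 ?invr_eq0 ?pnatr_eq0//.
    by rewrite ip_neq0//; apply: contraNneq (root_neq0 rB) => <-.
  by rewrite ipC.
have b0 : 0 < ip b b by apply: ip_gt0; apply: contraNneq (root_neq0 rB) => <-.
have ba0 : ip b a != 0 by rewrite ipC.
have [m /andP[m1 _] mE] := norm_ratio rB cB bB aB ba0 (ltW ba).
have [p /andP[p1 _] pE] := norm_ratio rB cB aB cB' ac0 (ltW ac).
have [q /andP[_ q3] qE] := norm_ratio rB cB bB cB' bc0 (ltW (lt_trans ba ac)).
have a0 : 0 < ip a a by exact: lt_trans ba.
have m2 : 1 < m by rewrite -(ltr_int K) -(ltr_pM2r b0) -mE mul1r.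
have p2 : 1 < p by rewrite -(ltr_int K) -(ltr_pM2r a0) -pE mul1r.
have : q = p * m.
  apply/(@intr_inj K)/(mulIf (lt0r_neq0 b0)).
  by rewrite -qE pE mE rmorphM mulrA.
by nia.
Qed.

(** * From equal lattices to equal orbits *)

(** The descent is shared by roots (phi the identity, T the short roots) and
coroots (phi the coroot map, T the long roots). *)
Lemma orbit_of_sum R (phi : V -> V) (T : V -> Prop) :
  (forall a, T a -> 0 < ip a (phi a)) ->
  (forall a b, T a -> b \in R \/ - b \in R -> 0 < ip a (phi b) ->
     a = b \/ T (refl b a) /\ phi (refl b a) = phi a - phi b) ->
  forall s a, T a ->
    (forall c, c \in s -> exists2 b, b \in R \/ - b \in R & c = phi b) ->
    phi a = \sum_(c <- s) c -> reflection_orbit ip R a.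
Proof.
move=> pos step s; move: {2}(size s) (leqnn (size s)) => n.
elim: n s => [|n IH] s sn a Ta sR aE.
  move: sn aE; rewrite leqn0 size_eq0 => /eqP ->; rewrite big_nil => a0.
  by have := pos a Ta; rewrite a0 linear0r ltxx.
have [c cs ac] : exists2 c, c \in s & 0 < ip a c.
  apply/hasP; apply: contraTT (pos a Ta) => /hasPn H.
  rewrite aE linear_sumr /= -leNgt big_seq sumr_le0// => c cs.
  by rewrite leNgt H.
have [b bR cE] := sR c cs; rewrite cE in ac.
have bO x : reflection_orbit ip R x -> reflection_orbit ip R (refl b x).
  by case: bR => bR; [|rewrite -reflN]; exact: orbit_refl.
have [->|[Tb bE]] := step a b Ta bR ac.
  by case: bR => bR; [|rewrite -[b]opprK; apply: orbit_opp]; exact: orbit_gen.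
rewrite -[a](reflectionK ip b); apply: bO; apply: (IH (rem c s)) => //.
- by rewrite size_rem//; case: (size s) sn.
- by move=> d /mem_rem /sR.
by rewrite bE aE (perm_big _ (perm_to_rem cs)) big_cons -cE addrC addKr.
Qed.

Lemma short_root_refl U B a g : root_system_in ip U B -> g \in B ->
  short_root B a -> short_root B (refl g a).
Proof.
move=> rB gB sa b bB; rewrite refl_adj refl_isom -(refl_isom g b b); apply: sa.
exact: root_refl rB gB bB.
Qed.

Lemma long_root_refl U B a g : root_system_in ip U B -> g \in B ->
  long_root B a -> long_root B (refl g a).
Proof.
move=> rB gB sa b bB; rewrite refl_adj refl_isom -(refl_isom g b b); apply: sa.
exact: root_refl rB gB bB.
Qed.

Lemma int_span_orbit U B R a : root_system_in ip U B -> crystallographic ip B ->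
  (R `<=` B)%fset -> a \in B -> int_span R a -> int_span (coroots ip R) (coroot ip a) ->
  reflection_orbit ip R a.
Proof.
move=> rB cB /fsubsetP RB aB ia ja.
have RB' b : b \in R \/ - b \in R -> b \in B.
  by case=> /RB // /(root_opp rB); rewrite opprK.
have B0 b : b \in B -> 0 < ip b b.
  by move=> bB; apply: ip_gt0; apply: contraNneq (root_neq0 rB) => <-.
have ipco b c : c \in B -> (0 < ip b (coroot ip c)) = (0 < ip b c).
  by move=> cB'; rewrite ipZr pmulr_rgt0// divr_gt0// B0.
have [sa|la] := short_or_long rB cB aB.
- have [s sR aE] := int_span_sum ia.
  apply: (@orbit_of_sum R id (fun b => b \in B /\ short_root B b) _ _ s) => //.
  + by move=> b [/B0].
  + move=> b c [bB sb] /RB' cB' bc; have [->|nbc] := eqVneq b c; first by left.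
    right; split.
      by split; [exact: root_refl rB cB' bB|exact: short_root_refl rB cB' sb].
    have [E _] := cartan_pos rB cB bB cB' nbc bc (sb _ cB' (lt0r_neq0 bc)).
    by rewrite reflectionE (ipC c b) E divff ?scale1r// gt_eqF// B0.
  + by move=> c /sR; exists c.
have [s sR aE] := int_span_sum ja.
apply: (@orbit_of_sum R (coroot ip) (fun b => b \in B /\ long_root B b) _ _ s) => //.
- by move=> b [bB _]; rewrite ipco// B0.
- move=> b c [bB sb] /RB' cB'; rewrite ipco// => bc.
  have [->|nbc] := eqVneq b c; first by left.
  right; split.
    by split; [exact: root_refl rB cB' bB|exact: long_root_refl rB cB' sb].
  have cb : 0 < ip c b by rewrite ipC.
  have ncb : c != b by rewrite eq_sym.
  have [E _] := cartan_pos rB cB cB' bB ncb cb (sb _ cB' (lt0r_neq0 bc)).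
  by rewrite coroot_refl (ipC b c) E divff ?scale1r// gt_eqF// B0.
move=> c /sR [/imfsetP[b /= bR ->]|/imfsetP[b /= bR cE]]; first by exists b => //; left.
by exists (- b); [right; rewrite opprK|rewrite corootN -cE opprK].
Qed.

End ReflectionSubgroups.

Theorem theorem1p1 (K : realType) (V : vectType K) (ip : {dot V for idfun})
    (n : nat) (Phi R Phi' : {fset V})
    (dimV : \dim {: V} = n)
    (rootPhi : root_system ip Phi) (crysPhi : crystallographic ip Phi)
    (sub_R_Phi : (R `<=` Phi)%fset) (R_neq0 : R <> fset0)
    (subsysPhi' : root_subsystem ip Phi Phi') (sub_R_Phi' : (R `<=` Phi')%fset) :
  [<-> [set` Phi']%classic = reflection_orbit ip R;
       reflection_group ip Phi' = reflection_group ip R;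
       int_span Phi' = int_span R /\
       int_span (coroots ip Phi') = int_span (coroots ip R)].
Proof.
have [/fsubsetP sub' root'] := subsysPhi'.
have crys' : crystallographic ip Phi' by move=> a b /sub' aP /sub' bP; exact: crysPhi.
have /fsubsetP RP := sub_R_Phi'.
tfae.
- move=> E; apply/seteqP; split=> f; last first.
    elim=> {f} [a /RP|||]; by [constructor|constructor|].
  elim=> {f} [a aP||f g _ Hf _ Hg|f _ Hf];
    [|exact: refl_group_id|exact: refl_group_comp|exact: refl_group_inv].
  have : reflection_orbit ip R a by rewrite -E.
  apply: (orbit_ind (P := fun a => in_reflection_group ip R (reflection ip a))).
    by move=> b; exact: refl_group_gen.
  move=> g b /refl_group_gen gR bR.
  have -> : reflection ip (reflection ip g b) =
      (reflection ip g \o (reflection ip b \o reflection ip g))%VF.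
    by apply/lfunP => v; rewrite !comp_lfunE refl_conj.
  by apply: refl_group_comp => //; apply: refl_group_comp.
- move=> E.
  have orb a : a \in Phi' -> reflection_orbit ip R a.
    move=> aP; apply: (reflection_in_group_orbit root') => //.
    rewrite -[in_reflection_group _ _ _]/(reflection_group ip R _) -E.
    exact: refl_group_gen.
  split; apply/seteqP; split; apply: int_span_sub.
  + by move=> a /orb /(orbit_int_span root' crys' sub_R_Phi')[].
  + by move=> a /RP; exact: int_span_gen.
  + by move=> _ /imfsetP[a /= /orb /(orbit_int_span root' crys' sub_R_Phi')[_ _ ?] ->].
  + by move=> _ /imfsetP[a /= /RP aP ->]; apply/int_span_gen/imfsetP; exists a.
- move=> [E1 E2]; apply/seteqP; split=> a /=; last first.
    by move=> /(orbit_int_span root' crys' sub_R_Phi')[].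
  move=> aP; apply: (int_span_orbit root') => //.
    by rewrite -E1; exact: int_span_gen.
  by rewrite -E2; apply/int_span_gen/imfsetP; exists a.
Qed.
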